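(* Suppose given the following data: (i) a group $Q$ and a normalized 3-cocycle $\omega\in Z^{3}(Q,\mathrm{U}(1))$; (ii) a group $G$ and a surjective homomorphism $\rho:G\to Q$ with kernel $K$; (iii) a normalized cochain $c\in C^{2}(G,\mathrm{U}(1))$ such that $dc=\rho^{*}(\omega)$; (iv) a C*-algebra $B$ and a group homomorphism $\pi:G\to\mathrm{Aut}(B)$ into the group of $*$-automorphisms of $B$. Then there exists an $\omega$-anomalous action of $Q$ on the reduced twisted crossed product $B\rtimes_{\pi,c}K$, where $c\in Z^{2}(K,\mathrm{U}(1))$ denotes the restriction of $c$ to $K$.
   Context: All groups are discrete and act trivially on $\mathrm{U}(1)$, the complex numbers of modulus one. $C^{k}(G,\mathrm{U}(1))$ is the set of normalized cochains, i.e. functions $G^{k}\to\mathrm{U}(1)$ taking the value $1$ whenever some argument is $1$. For $c\in C^2(G,\mathrm{U}(1))$, $dc(f,g,h)=c(g,h)^{-1}c(fg,h)c(f,gh)^{-1}c(f,g)$. $Z^{2}(K,\mathrm{U}(1))$ is the set of normalized 2-cochains with $dc=1$. $Z^{3}(Q,\mathrm{U}(1))$ is the set of normalized 3-cochains $\omega$ with $\omega(gh,k,l)\,\omega(g,h,kl)=\omega(h,k,l)\,\omega(g,hk,l)\,\omega(g,h,k)$. The pullback is $\rho^{*}(\omega)(f,g,h)=\omega(\rho(f),\rho(g),\rho(h))$. (Since $\omega$ is normalized, $dc=\rho^*(\omega)$ forces $c|_{K}$ to be a normalized 2-cocycle.) The reduced twisted crossed product $B\rtimes_{\pi,c}K$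 is the reduced C*-completion (via the regular representation) of the $*$-algebra $\bigoplus_{k\in K}Bu_k$ of finite sums, with relations $u_ku_l=c(k,l)u_{kl}$, $u_kb=\pi(k)(b)u_k$ for $b\in B$, and $u_k$ unitary (in the multiplier algebra). For a group $Q$, $\omega\in Z^{3}(Q,\mathrm{U}(1))$ and a C*-algebra $D$ with multiplier algebra $M(D)$, an $\omega$-anomalous action of $Q$ on $D$ is an assignment of a $*$-automorphism $\alpha_{q}\in\mathrm{Aut}(D)$ to each $q\in Q$ and a unitary $m_{q,r}\in M(D)$ to each pair $q,r\in Q$ such that (1) $m_{q,r}\,\alpha_{q}(\alpha_{r}(x))=\alpha_{qr}(x)\,m_{q,r}$ for all $x\in D$, and (2) $\omega(q,r,s)\,m_{qr,s}\,m_{q,r}=m_{q,rs}\,\alpha_{q}(m_{r,s})$ for all $q,r,s\in Q$, where $\alpha_q$ also denotes its unique extension to $M(D)$. *)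

(* Defs.v *)
From HB Require Import structures.
From mathcomp Require Import all_boot all_order all_algebra.
From mathcomp Require Import complex.
From mathcomp Require Import all_classical all_reals all_analysis.

Set Implicit Arguments.
Unset Strict Implicit.
Unset Printing Implicit Defensive.

Import Order.TTheory GRing.Theory Num.Theory.
Import numFieldNormedType.Exports.

Local Open Scope classical_set_scope.
Local Open Scope complex_scope.
Local Open Scope ring_scope.

HB.mixin Record isCStarAlgebra (R : realType) A
    of CompleteNormedModule R[i] A := {
  amul : A -> A -> A;
  astar : A -> A;
  amulA : associative amul;
  amulDl : left_distributive amul +%R;
  amulDr : right_distributive amul +%R;
  amulZl : forall (z : R[i]) (x y : A), amul (z *: x) y = z *: amul x y;
  amulZr : forall (z : R[i]) (x y : A), amul x (z *: y) = z *: amul x y;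
  astarK : involutive astar;
  astarD : {morph astar : x y / x + y};
  astarZ : forall (z : R[i]) (x : A), astar (z *: x) = z^* *: astar x;
  astarM : forall x y : A, astar (amul x y) = amul (astar y) (astar x);
  norm_amul : forall x y : A, `|amul x y| <= `|x| * `|y|;
  norm_astar_amul : forall x : A, `|amul (astar x) x| = `|x| ^+ 2
}.

#[short(type="cstarAlgType")]
HB.structure Definition CStarAlgebra (R : realType) :=
  {A of isCStarAlgebra R A & CompleteNormedModule R[i] A}.

Notation "x ** y" := (amul x y) (at level 40, left associativity) : ring_scope.

(** [R[i]]-valued norms are nonnegative reals; [rnorm] is the norm as an element
    of [R]. *)
Definition rnorm (R : realType) (V : normedModType R[i]) (x : V) : R :=
  complex.Re `|x|.

Record star_aut (R : realType) (A : cstarAlgType R) := StarAut {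
  aut_fun :> A -> A;
  aut_inv : A -> A;
  aut_funK : cancel aut_fun aut_inv;
  aut_invK : cancel aut_inv aut_fun;
  aut_linear : forall (z : R[i]) (x y : A),
    aut_fun (z *: x + y) = z *: aut_fun x + aut_fun y;
  aut_mul : forall x y : A, aut_fun (x ** y) = aut_fun x ** aut_fun y;
  aut_astar : forall x : A, aut_fun (astar x) = astar (aut_fun x)
}.

(** The multiplier algebra is the algebra of double centralizers: the multiplier
    [m] is the pair of maps [x |-> m x] and [x |-> x m].  As in Busby's definition, linearity and boundedness of the two
    maps are not required: they follow from [mult_centralizer]. *)
Record multiplier (R : realType) (A : cstarAlgType R) := Multiplier {
  lmult : A -> A;
  rmult : A -> A;
  mult_centralizer : forall x y : A, x ** lmult y = rmult x ** y
}.

Lemma mult_one_subproof (R : realType) (A : cstarAlgType R) (x y : A) :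
  x ** id y = id x ** y.
Proof. by []. Qed.

Definition mult_one (R : realType) (A : cstarAlgType R) : multiplier A :=
  Multiplier (@mult_one_subproof R A).

Lemma mult_mul_subproof (R : realType) (A : cstarAlgType R)
    (m n : multiplier A) (x y : A) :
  x ** (lmult m \o lmult n) y = (rmult n \o rmult m) x ** y.
Proof. by rewrite /= !mult_centralizer. Qed.

Definition mult_mul (R : realType) (A : cstarAlgType R) (m n : multiplier A) :
  multiplier A := Multiplier (mult_mul_subproof m n).

Lemma mult_scale_subproof (R : realType) (A : cstarAlgType R) (z : R[i])
    (m : multiplier A) (x y : A) :
  x ** (z *: lmult m y) = (z *: rmult m x) ** y.
Proof. by rewrite amulZl amulZr mult_centralizer. Qed.

Definition mult_scale (R : realType) (A : cstarAlgType R) (z : R[i])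
  (m : multiplier A) : multiplier A := Multiplier (mult_scale_subproof z m).

Lemma mult_adj_subproof (R : realType) (A : cstarAlgType R)
    (m : multiplier A) (x y : A) :
  x ** astar (rmult m (astar y)) = astar (lmult m (astar x)) ** y.
Proof.
by apply: (can_inj astarK); rewrite !astarM !astarK mult_centralizer.
Qed.

Definition mult_adj (R : realType) (A : cstarAlgType R) (m : multiplier A) :
  multiplier A := Multiplier (mult_adj_subproof m).

Lemma aut_mult_subproof (R : realType) (A : cstarAlgType R)
    (a : star_aut A) (m : multiplier A) (x y : A) :
  x ** a (lmult m (aut_inv a y)) = a (rmult m (aut_inv a x)) ** y.
Proof.
by rewrite -{1}(aut_invK a x) -{2}(aut_invK a y) -!aut_mul mult_centralizer.
Qed.

(** The unique extension of [a] to the multiplier algebra: it is determined by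
    [a(m) a(x) = a(m x)] and [a(x) a(m) = a(x m)]. *)
Definition aut_mult (R : realType) (A : cstarAlgType R) (a : star_aut A)
  (m : multiplier A) : multiplier A := Multiplier (aut_mult_subproof a m).

Definition mult_unitary (R : realType) (A : cstarAlgType R)
    (m : multiplier A) : Prop :=
  mult_mul (mult_adj m) m = mult_one A /\ mult_mul m (mult_adj m) = mult_one A.

(** U(1)-valued cochains are encoded as [R[i]]-valued functions of modulus one. *)

Definition cochain2 (R : realType) (G : groupType) (c : G -> G -> R[i]) : Prop :=
  [/\ forall g h, `|c g h| = 1, forall g, c 1%g g = 1 & forall g, c g 1%g = 1].

Definition cochain3 (R : realType) (G : groupType)
    (w : G -> G -> G -> R[i]) : Prop :=
  (forall f g h, `|w f g h| = 1) /\
  [/\ forall g h, w 1%g g h = 1, forall g h, w g 1%g h = 1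
    & forall g h, w g h 1%g = 1].

Definition coboundary2 (R : realType) (G : groupType) (c : G -> G -> R[i]) :
    G -> G -> G -> R[i] :=
  fun f g h => (c g h)^-1 * c (f * g)%g h * (c f (g * h)%g)^-1 * c f g.

Definition cocycle3 (R : realType) (G : groupType)
    (w : G -> G -> G -> R[i]) : Prop :=
  cochain3 w /\
  forall g h k l, w (g * h)%g k l * w g h (k * l)%g =
                  w h k l * w g (h * k)%g l * w g h k.

Definition pullback3 (R : realType) (G Q : groupType) (rho : G -> Q)
    (w : Q -> Q -> Q -> R[i]) : G -> G -> G -> R[i] :=
  fun f g h => w (rho f) (rho g) (rho h).

Definition in_ker (G Q : groupType) (rho : {multiplicative G -> Q}) :
  {pred G} := fun g => rho g == 1%g.

Lemma in_ker_closed (G Q : groupType) (rho : {multiplicative G -> Q}) :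
  group_closed (in_ker rho).
Proof.
have rho1 : rho 1%g = 1%g.
  by apply: (@mulgI _ (rho 1%g)); rewrite -gmulfM !mulg1.
have rhoV g : rho g^-1%g = (rho g)^-1%g.
  by apply: (@mulgI _ (rho g)); rewrite -gmulfM !mulgV rho1.
split; first by apply/eqP.
move=> g h /eqP gK /eqP hK; apply/eqP.
by rewrite gmulfM rhoV gK hK invg1 mulg1.
Qed.

Definition group_ker (G Q : groupType) (rho : {multiplicative G -> Q}) : Type :=
  {g : G | in_ker rho g}.

HB.instance Definition _ (G Q : groupType) (rho : {multiplicative G -> Q}) :=
  Choice.on (group_ker rho).
HB.instance Definition _ (G Q : groupType) (rho : {multiplicative G -> Q}) :=
  SubChoice.on (group_ker rho).
HB.instance Definition _ (G Q : groupType) (rho : {multiplicative G -> Q}) :=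
  SubChoice_isSubGroup.Build G (in_ker rho) (group_ker rho) (in_ker_closed rho).

(** A finite sum [\sum_k (x k) u_k] is encoded by the finitely supported function
    [x : K -> B] of its coefficients.  Sums over [[set: K]] below are used only
    on such functions, where they have finite support. *)
Definition finsupp (K : choiceType) (V : nmodType) : set (K -> V) :=
  [set x | finite_set [set k | x k != 0]].

(** Product of finite sums, forced by [u_k b = pi_k(b) u_k] and
    [u_k u_l = c(k,l) u_(kl)]: the coefficient at [m] collects
    [(x k) u_k (y l) u_l = c(k,l) (x k) pi_k(y l) u_(kl)] over [kl = m]. *)
Definition twisted_mul (R : realType) (K : groupType) (B : cstarAlgType R)
    (c : K -> K -> R[i]) (pi : K -> star_aut B) (x y : K -> B) : K -> B :=
  fun m => \sum_(k \in [set: K])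
    c k (k^-1 * m)%g *: (x k ** pi k (y (k^-1 * m)%g)).

(** Adjoint of finite sums: as [u_l] is unitary and [u_1 = 1],
    [u_l^* = conj(c(l^-1,l)) u_(l^-1)], hence
    [(b u_l)^* = conj(c(l^-1,l)) pi_(l^-1)(b^* ) u_(l^-1)]. *)
Definition twisted_astar (R : realType) (K : groupType) (B : cstarAlgType R)
    (c : K -> K -> R[i]) (pi : K -> star_aut B) (x : K -> B) : K -> B :=
  fun k => (c k k^-1%g)^* *: pi k (astar (x k^-1%g)).

(** The norm of the right Hilbert [B]-module l^2(K,B), on the dense submodule of
    finitely supported functions. *)
Definition l2norm (R : realType) (K : groupType) (B : cstarAlgType R)
    (xi : K -> B) : R :=
  Num.sqrt (rnorm (\sum_(k \in [set: K]) astar (xi k) ** xi k)).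

(** The regular representation on l^2(K,B):
    [b] acts by [(b xi)(l) = pi_(l^-1)(b) xi(l)] and
    [u_k] acts by [(u_k xi)(l) = c(k, k^-1 l) xi(k^-1 l)]. *)
Definition regular_rep (R : realType) (K : groupType) (B : cstarAlgType R)
    (c : K -> K -> R[i]) (pi : K -> star_aut B) (x : K -> B) (xi : K -> B) :
    K -> B :=
  fun l => \sum_(k \in [set: K])
    pi l^-1%g (x k) ** (c k (k^-1 * l)%g *: xi (k^-1 * l)%g).

(** The operator norm on l^2(K,B) of [x] in the regular representation; it is
    the supremum over the unit ball of the dense submodule. *)
Definition reduced_norm (R : realType) (K : groupType) (B : cstarAlgType R)
    (c : K -> K -> R[i]) (pi : K -> star_aut B) (x : K -> B) : \bar R :=
  ereal_sup [set (l2norm (regular_rep c pi x xi))%:E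
            | xi in [set xi : K -> B | finsupp xi /\ l2norm xi <= 1]].

(** A C*-algebra which is the completion, for the reduced norm, of the *-algebra
    of finite sums.  The values of [rcp_incl] outside [finsupp] are irrelevant. *)
Record reduced_crossed_product (R : realType) (K : groupType)
    (B : cstarAlgType R) (c : K -> K -> R[i]) (pi : K -> star_aut B) :=
  ReducedCrossedProduct {
  rcp_alg :> cstarAlgType R;
  rcp_incl : (K -> B) -> rcp_alg;
  rcp_linear : forall (z : R[i]) (x y : K -> B), finsupp x -> finsupp y ->
    rcp_incl (fun k => z *: x k + y k) = z *: rcp_incl x + rcp_incl y;
  rcp_mul : forall x y : K -> B, finsupp x -> finsupp y ->
    rcp_incl (twisted_mul c pi x y) = rcp_incl x ** rcp_incl y;
  rcp_astar : forall x : K -> B, finsupp x ->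
    rcp_incl (twisted_astar c pi x) = astar (rcp_incl x);
  rcp_norm : forall x : K -> B, finsupp x ->
    (rnorm (rcp_incl x))%:E = reduced_norm c pi x;
  rcp_dense : dense (rcp_incl @` @finsupp K B)
}.

Definition anomalous_action (R : realType) (Q : groupType)
    (w : Q -> Q -> Q -> R[i]) (D : cstarAlgType R)
    (alpha : Q -> star_aut D) (m : Q -> Q -> multiplier D) : Prop :=
  [/\ forall q r, mult_unitary (m q r),
      forall q r (x : D),
        lmult (m q r) (alpha q (alpha r x)) =
        rmult (m q r) (alpha (q * r)%g x)
    & forall q r s,
        mult_scale (w q r s) (mult_mul (m (q * r)%g s) (m q r)) =
        mult_mul (m q (r * s)%g) (aut_mult (alpha q) (m r s))].

(* Main.v *)
Require Import Defs.
From HB Require Import structures.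
From mathcomp Require Import all_boot all_order all_algebra.
From mathcomp Require Import complex.
From mathcomp Require Import ring.
From mathcomp Require Import all_classical all_reals all_analysis.

Set Implicit Arguments.
Unset Strict Implicit.
Unset Printing Implicit Defensive.

Import Order.TTheory GRing.Theory Num.Theory.
Import numFieldNormedType.Exports.

Local Open Scope classical_set_scope.
Local Open Scope complex_scope.
Local Open Scope ring_scope.

(** Think of [B] as sitting inside an algebra spanned by elements [b u_g] with
    [g] in [G], where [u_g b = pi_g(b) u_g] and [u_g u_h = c(g,h) u_(gh)].  As
    [dc] is the pullback of [omega], this product is associative only up to
    [omega]:
      [(u_f u_g) u_h = omega(rho f, rho g, rho h) u_f (u_g u_h)].
    As [omega] is normalized, the associator disappears as soon as one of the
    three indices is in [K].  So the part of the algebra supported on [K] is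
    the ordinary twisted crossed product, and conjugation [Ad_g] by [u_g] is a
    genuine action of [G] on it:
      [Ad_g(b u_k) = pi_g(b) c(g,k) c(gkg^-1,g)^-1 u_(gkg^-1)].

    Choose a section [s] of [rho], let [alpha_q = Ad_(s q)], and let [m_(q,r)]
    be the multiple of a [u_j], with [j] in [K], such that
      [m_(q,r) (u_(s q) u_(s r)) = u_(s (qr))].
    The first condition on an anomalous action holds because [Ad] is an action
    and because [Ad_j], for [j] in [K], is conjugation by the multiplier [u_j].
    For the second condition, compare the two ways of multiplying [u_(s q)],
    [u_(s r)] and [u_(s t)] to reach [u_(s (qrt))]: they differ exactly by the
    associator.  Written out, this is [anomaly_phase_identity], a consequence
    of six instances of the cocycle identity.

    What remains is analysis: [Ad_g], and left and right multiplication by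
    [u_k], are given on finite sums and must extend to the completion.  For
    this it is enough that they do not increase the reduced norm
    ([nonexpansive_ext_dense]), and all identities then pass to the completion
    by density ([continuous_eq_dense]).  For multiplication by [u_k] the norm
    estimate comes from a unitary of [l^2(K,B)].  For [Ad_g] the same formula
    on [l^2(K,B)] intertwines the regular representations of [x] and [Ad_g(x)],
    and it preserves the norm of [l^2(K,B)] because the *-automorphism [pi_g]
    of [B] is isometric ([norm_star_aut]).

    That a *-automorphism [f] is isometric is proved without spectral theory.
    If [h] is self-adjoint with [|h| < 1], the equation [h^2 + y^2 = 1] has a
    self-adjoint solution [y = 1 - z] commuting with [h], found by iterating a
    contraction.  The equation is preserved by [f], and it makes [f(h) + i
    f(y)] a unitary whose real part is [f(h)]; so [|f(h)| <= 1]. *)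

(** * Geometric convergence over the complex numbers *)

Lemma geometric_small (R : realType) (q e : R[i]) :
  0 <= q -> q < 1 -> 0 < e -> exists n, q ^+ n < e.
Proof.
move=> q0 q1 e0.
have qE : q = (complex.Re q)%:C by rewrite RRe_real ?ger0_real.
have eE : e = (complex.Re e)%:C by rewrite RRe_real ?gtr0_real.
move: q0 q1 e0; rewrite qE eE.
move: (complex.Re q) (complex.Re e) => {qE eE} r t.
rewrite ler0c !ltcR => r0 r1 t0.
have /cvgrPdist_lt/(_ _ t0) : r ^+ n @[n --> \oo] --> 0.
  by apply: cvg_expr; rewrite ger0_norm.
move=> [N _ /(_ N (leqnn N))] /=; rewrite sub0r normrN ger0_norm ?exprn_ge0//.
by move=> rt; exists N; rewrite -rmorphXn ltcR.
Qed.

Lemma geometric_le0 (R : realType) (q C x : R[i]) :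
  0 <= q -> q < 1 -> 0 <= C -> (forall n, x <= C * q ^+ n) -> x <= 0.
Proof.
move=> q0 q1 C0 xP; apply/ler_addgt0Pr => e e0; rewrite add0r.
have C1 : 0 < C + 1 by apply: ltr_wpDl.
have [n qn] := geometric_small q0 q1 (divr_gt0 e0 C1).
apply: le_trans (xP n) _; apply: le_trans (_ : (C + 1) * q ^+ n <= _).
  by rewrite ler_wpM2r ?exprn_ge0// lerDl.
by rewrite mulrC -ler_pdivlMr// ltW.
Qed.

(** A form of the contraction principle in which no geometric series has to be
    summed: if the iterates from 0 of a contraction stay in the unit ball, they
    satisfy the hypothesis, because [u (m + n)] and [u n] are the images of [u
    m] and [u 0] under its [n]-th iterate. *)
Lemma geometric_cvg (R : realType) (V : completeNormedModType R[i])
    (u : nat -> V) (q : R[i]) :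
  0 <= q -> q < 1 -> (forall m n, `|u (m + n)%N - u n| <= q ^+ n) ->
  exists z, forall n, `|z - u n| <= q ^+ n.
Proof.
move=> q0 q1 uP.
have : cauchy_ex (u @ \oo).
  move=> e e0; have [n qn] := geometric_small q0 q1 e0.
  exists (u n); exists n => //= k nk; rewrite -ball_normE/= distrC.
  by apply: le_lt_trans qn; rewrite -(subnK nk).
move=> /cauchy_exP /cauchy_cvg uc.
exists (lim (u @ \oo)) => n; apply/ler_addgt0Pr => e e0.
move/cvgrPdist_lt/(_ _ e0) : uc => [N _ uN].
have /uN /= : (N <= N + n)%N by apply: leq_addr.
move=> lt_e; apply: le_trans (ler_distD (u (N + n)%N) _ _) _.
by rewrite addrC lerD// ltW.
Qed.

(** * Automorphisms of C*-algebras are isometric *)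

Section CStarArithmetic.
Context {R : realType} {A : cstarAlgType R}.
Implicit Types x y z : A.

Lemma amul0l x : 0 ** x = 0.
Proof. by rewrite -(scale0r (0 : A)) amulZl !scale0r. Qed.

Lemma amul0r x : x ** 0 = 0.
Proof. by rewrite -(scale0r (0 : A)) amulZr !scale0r. Qed.

Lemma amulNl x y : (- x) ** y = - (x ** y).
Proof. by rewrite -scaleN1r amulZl scaleN1r. Qed.

Lemma amulNr x y : x ** (- y) = - (x ** y).
Proof. by rewrite -scaleN1r amulZr scaleN1r. Qed.

Lemma amulBl x y z : (x - y) ** z = x ** z - y ** z.
Proof. by rewrite amulDl amulNl. Qed.

Lemma amulBr x y z : x ** (y - z) = x ** y - x ** z.
Proof. by rewrite amulDr amulNr. Qed.

Lemma astar0 : astar 0 = 0 :> A.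
Proof. by apply: (addrI (astar 0)); rewrite -astarD !addr0. Qed.

Lemma astarN x : astar (- x) = - astar x.
Proof. by apply: (addrI (astar x)); rewrite -astarD !subrr astar0. Qed.

Lemma astarB x y : astar (x - y) = astar x - astar y.
Proof. by rewrite astarD astarN. Qed.

Lemma le_norm_astar x : `|x| <= `|astar x|.
Proof.
have [->|x0] := eqVneq x 0; first by rewrite astar0.
rewrite -(ler_pM2r (_ : 0 < `|x|)) ?normr_gt0// -expr2 -norm_astar_amul.
exact: norm_amul.
Qed.

Lemma norm_astar x : `|astar x| = `|x|.
Proof.
apply/le_anti/andP; split; last exact: le_norm_astar.
by have := le_norm_astar (astar x); rewrite astarK.
Qed.

Lemma norm_amul_sqr_diff (C : R[i]) x y : `|x| <= C -> `|y| <= C ->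
  `|x ** x - y ** y| <= (C * 2) * `|x - y|.
Proof.
move=> xC yC.
have -> : x ** x - y ** y = x ** (x - y) + (x - y) ** y.
  by rewrite amulBr amulBl addrA subrK.
apply: le_trans (ler_normD _ _) _; rewrite mulr_natr mulr2n mulrDl.
apply: lerD; apply: le_trans (norm_amul _ _) _.
  by rewrite ler_wpM2r.
by rewrite mulrC ler_wpM2r.
Qed.

End CStarArithmetic.

Section CStarIsometry.
Context {R : realType}.

(** The element [z] is [1 - sqrt(1 - h^2)], in an algebra that may have no
    unit: [h^2 + (1 - z)^2 = 1] is rewritten as the last equation.  It is the
    fixed point of [z |-> (h^2 + z^2) / 2], which maps the ball of radius [|h|]
    to itself and contracts it by the factor [|h|].  Self-adjointness and
    commutation with [h] hold for all iterates from [0], hence for their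
    limit. *)
Lemma exists_one_sub_sqrt (A : cstarAlgType R) (h : A) :
  astar h = h -> `|h| < 1 ->
  exists z : A, [/\ astar z = z, z ** h = h ** z & z + z = h ** h + z ** z].
Proof.
move=> hs h1; pose q := `|h|; have q0 : 0 <= q by apply: normr_ge0.
pose f (z : A) := 2^-1 *: (h ** h + z ** z).
have fq (x y : A) : `|x| <= q -> `|y| <= q -> `|f x - f y| <= q * `|x - y|.
  move=> xq yq; rewrite -scalerBr normrZ ger0_norm ?invr_ge0//.
  rewrite opprD addrACA subrr add0r.
  apply: le_trans (ler_wpM2l _ (norm_amul_sqr_diff xq yq)) _.
    by rewrite invr_ge0.
  by rewrite mulrA [q * 2]mulrC mulKf.
pose u n := iter n f 0.
have uq n : `|u n| <= q.
  elim: n => [|n IH]; first by rewrite normr0.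
  rewrite /= /f normrZ ger0_norm ?invr_ge0// -ler_pdivlMl ?invr_gt0// invrK.
  apply: le_trans (ler_normD _ _) _; rewrite mulr_natl mulr2n.
  apply: lerD; (apply: le_trans (norm_amul _ _) _).
    by rewrite ler_piMl// ltW.
  rewrite (le_trans _ IH)// ler_piMl//.
  exact: le_trans IH (ltW h1).
have uc m n : `|u (m + n)%N - u n| <= q ^+ n.
  elim: n => [|n IH].
    by rewrite expr0 subr0 addn0 (le_trans (uq m))// ltW.
  rewrite addnS /= exprS; apply: le_trans (fq _ _ (uq _) (uq _)) _.
  by rewrite ler_wpM2l.
have us n : astar (u n) = u n.
  elim: n => [|n IH]; first by rewrite astar0.
  by rewrite /= /f astarZ astarD !astarM hs -/(u n) IH fmorphV rmorph_nat.
have uh n : u n ** h = h ** u n.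
  elim: n => [|n IH]; first by rewrite amul0l amul0r.
  by rewrite /= /f amulZl amulZr amulDl amulDr -/(u n) !amulA -IH -!amulA IH.
have [z zP] := geometric_cvg q0 h1 uc.
have limit0 C (v : A) : 0 <= C -> (forall n, `|v| <= C * q ^+ n) -> v = 0.
  move=> C0 vP; apply/normr0_eq0/le_anti; rewrite normr_ge0 andbT.
  exact: geometric_le0 vP.
have zq : `|z| <= q.
  rewrite -subr_le0; apply: (geometric_le0 q0 h1 ler01) => n.
  rewrite mul1r lerBlDr; apply: le_trans (lerD (zP n) (uq n)).
  by rewrite -{1}(subrK (u n) z) ler_normD.
exists z; split.
- apply/eqP; rewrite -subr_eq0; apply/eqP/(limit0 2) => // n.
  rewrite -(subrK (u n) z) astarD us opprD addrACA subrr addr0.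
  apply: le_trans (ler_normB _ _) _.
  by rewrite norm_astar mulr_natl mulr2n lerD.
- apply/eqP; rewrite -subr_eq0; apply/eqP/(limit0 (2 * q)) => [|n].
    by rewrite mulr_ge0.
  rewrite -(subrK (u n) z) amulDl amulDr uh opprD addrACA subrr addr0.
  apply: le_trans (ler_normB _ _) _; rewrite -mulrA mulr_natl mulr2n.
  apply: lerD; apply: le_trans (norm_amul _ _) _.
    by rewrite mulrC ler_wpM2l.
  by rewrite ler_wpM2l.
- suff -> : h ** h + z ** z = 2 *: z by rewrite scaler_nat mulr2n.
  rewrite -[LHS](scalerKV (_ : 2 != 0 :> R[i])) ?pnatr_eq0// -/(f z).
  congr (_ *: _).
  apply/eqP; rewrite -subr_eq0; apply/eqP/(limit0 2) => // n.
  rewrite -(subrK (u n.+1) (f z)) -addrA mulr_natl mulr2n.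
  apply: le_trans (ler_normD _ _) _; apply: lerD.
    apply: le_trans (fq _ _ zq (uq n)) _; apply: le_trans (zP n).
    by rewrite ler_piMl// ltW.
  rewrite distrC; apply: le_trans (zP _) _.
  by rewrite exprS ler_piMl ?exprn_ge0// ltW.
Qed.

(** With [y = 1 - z], the hypotheses say that [h + i y] and [h - i y] are
    unitary elements of the unitization.  So left multiplication by each of
    them is isometric, and [h], half of their sum, satisfies [|h x| <= |x|] for
    all [x]. Taking [x = h] gives [|h|^2 <= |h|]. *)
Lemma norm_le1_of_sqr_sum1 (A : cstarAlgType R) (h z : A) :
  astar h = h -> astar z = z -> z ** h = h ** z -> z + z = h ** h + z ** z ->
  `|h| <= 1.
Proof.
move=> hs zs zh zz.
have isom (e : R[i]) (x : A) : e^* = - e -> e * e = -1 ->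
    `|h ** x + e *: (x - z ** x)| = `|x|.
  move=> es ee; apply/eqP.
  rewrite -(eqrXn2 (_ : (0 < 2)%N))// -!norm_astar_amul; apply/eqP.
  congr (`|_|).
  (* As [h] and [y] commute, the two cross terms of the square agree; they come
     with the coefficients [e] and [- e]. *)
  have cross : astar (h ** x) ** (x - z ** x) = astar (x - z ** x) ** (h ** x).
    rewrite astarM astarB astarM hs zs amulBl amulBr -!amulA.
    by rewrite (amulA z) zh -!amulA.
  have sqr1 : astar (h ** x) ** (h ** x) + astar (x - z ** x) ** (x - z ** x) =
      astar x ** x.
    rewrite astarB !astarM hs zs amulBl !amulBr !amulA.
    rewrite -(amulA (astar x) h h) -(amulA (astar x) z z).
    rewrite [RHS](_ : _ = astar x ** x + (astar x ** (h ** h + z ** z) ** x -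
                    astar x ** (z + z) ** x)); last by rewrite zz subrr addr0.
    rewrite !amulDr !amulDl opprB opprD.
    set a := _ ** (h ** h) ** x; set b := _ ** (z ** z) ** x.
    set p := astar x ** x; set r := _ ** z ** x.
    by rewrite (addrACA p) !addrA (addrC a p).
  rewrite astarD astarZ es amulDl !amulDr !amulZl !amulZr scalerA mulNr ee.
  by rewrite opprK scale1r cross scaleNr addrA addrK.
have ie : 'i * 'i = -1 :> R[i] by rewrite -expr2 sqrCi.
have is_i : 'i^* = - 'i :> R[i] by exact: conjCi.
have bound x : `|h ** x| <= `|x|.
  rewrite -(ler_pM2l (_ : 0 < (2 : R[i])))// -[2 in leLHS]ger0_norm//.
  rewrite -normrZ mulr_natl mulr2n.
  have -> : 2 *: (h ** x) = (h ** x + 'i *: (x - z ** x)) +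
                           (h ** x + (- 'i) *: (x - z ** x)).
    by rewrite addrACA -scalerDl subrr scale0r addr0 scaler_nat mulr2n.
  apply: le_trans (ler_normD _ _) _.
  by rewrite (isom _ _ is_i ie) isom ?mulrNN// rmorphN/= is_i.
have [->|h0] := eqVneq h 0; first by rewrite normr0.
have := bound h; rewrite -{1}hs norm_astar_amul expr2 -{3}(mul1r `|h|).
by rewrite ler_pM2r// normr_gt0.
Qed.

Lemma star_aut0 (A : cstarAlgType R) (f : star_aut A) : f 0 = 0.
Proof.
have := aut_linear f 1 0 0; rewrite !scale1r addr0 => /eqP.
by rewrite -subr_eq subrr => /eqP.
Qed.

Lemma star_autD (A : cstarAlgType R) (f : star_aut A) x y :
  f (x + y) = f x + f y.
Proof. by have := aut_linear f 1 x y; rewrite !scale1r. Qed.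

Lemma star_autZ (A : cstarAlgType R) (f : star_aut A) a x :
  f (a *: x) = a *: f x.
Proof. by have := aut_linear f a x 0; rewrite star_aut0 !addr0. Qed.

Lemma star_aut_inj (A : cstarAlgType R) (f : star_aut A) : injective f.
Proof. exact: can_inj (aut_funK f). Qed.

(** The relations between [h] and [1 - sqrt(1 - h^2)] are algebraic, so [f]
    preserves them, and they bound the norm of [f h].  The argument applies to
    elements of norm below one; this is why [h] is divided by some [t > |h|]. *)
Lemma star_aut_self_adjoint_le (A : cstarAlgType R) (f : star_aut A) (h : A) :
  astar h = h -> `|f h| <= `|h|.
Proof.
move=> hs; apply/ler_addgt0Pr => e e0.
pose t := `|h| + e; have t0 : 0 < t by apply: ltr_wpDl.
have ts : (t^-1)^* = t^-1 by rewrite conj_Creal// ger0_real// invr_ge0 ltW.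
have ht : `|t^-1 *: h| < 1.
  by rewrite normrZ gtr0_norm ?invr_gt0// mulrC ltr_pdivrMr// mul1r ltrDl.
have [|z [zs zh zz]] := exists_one_sub_sqrt _ ht; first by rewrite astarZ ts hs.
have : `|f (t^-1 *: h)| <= 1.
  apply: (@norm_le1_of_sqr_sum1 _ _ (f z)).
  - by rewrite -aut_astar astarZ ts hs.
  - by rewrite -aut_astar zs.
  - by rewrite -!aut_mul zh.
  - by rewrite -star_autD zz star_autD !aut_mul.
by rewrite star_autZ normrZ gtr0_norm ?invr_gt0// mulrC ler_pdivrMr// mul1r.
Qed.

(** The C*-identity reduces the general case to the self-adjoint element
    [x^* x]. *)
Lemma star_aut_le (A : cstarAlgType R) (f : star_aut A) (x : A) :
  `|f x| <= `|x|.
Proof.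
rewrite -(ler_pXn2r (_ : (0 < 2)%N)) ?nnegrE//.
rewrite -!norm_astar_amul -aut_astar -aut_mul.
by apply: star_aut_self_adjoint_le; rewrite astarM astarK.
Qed.

Definition star_aut_inv (A : cstarAlgType R) (f : star_aut A) : star_aut A.
Proof.
apply: (@StarAut _ _ (aut_inv f) f (aut_invK f) (aut_funK f)).
- by move=> a x y; apply: (can_inj (aut_funK f)); rewrite aut_linear !aut_invK.
- by move=> x y; apply: (can_inj (aut_funK f)); rewrite aut_mul !aut_invK.
- by move=> x; apply: (can_inj (aut_funK f)); rewrite aut_astar !aut_invK.
Defined.

Lemma norm_star_aut (A : cstarAlgType R) (f : star_aut A) (x : A) :
  `|f x| = `|x|.
Proof.
apply/le_anti; rewrite star_aut_le/=.
by have := star_aut_le (star_aut_inv f) (f x); rewrite /= aut_funK.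
Qed.

End CStarIsometry.

(** * Extension of maps from dense subsets *)

Section DenseSubsets.
Context {K : numFieldType}.

Lemma dense_within_proper (V : normedModType K) (S : set V) (d : V) :
  dense S -> ProperFilter (within S (nbhs d)).
Proof.
move=> dS; apply: within_nbhs_proper => U Ud.
have [|s [sU sS]] := dS (interior U) _ (open_interior U).
  by exists d; exact: nbhs_singleton (nbhs_interior Ud).
by exists s; split => //; exact: interior_subset.
Qed.

Lemma continuous_eq_dense (V W : normedModType K) (S : set V) (f g : V -> W) :
  dense S -> continuous f -> continuous g -> {in S, f =1 g} -> f =1 g.
Proof.
move=> dS fc gc fg d.
have FF := dense_within_proper d dS.
have fd : f @ within S (nbhs d) --> f d by exact: cvg_within_filter (fc d).
have gd : g @ within S (nbhs d) --> g d by exact: cvg_within_filter (gc d).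
apply: (cvg_unique _ fd); first exact: norm_hausdorff.
apply: cvg_trans gd; apply: near_eq_cvg.
by rewrite near_withinE; near=> x => xS; rewrite fg ?inE.
Unshelve. all: by end_near. Qed.

Lemma lipschitz_continuous (V W : normedModType K) (C : K) (f : V -> W) :
  0 <= C -> (forall x y, `|f x - f y| <= C * `|x - y|) -> continuous f.
Proof.
move=> C0 fC d; apply/cvgrPdist_lt => e e0.
have C1 : 0 < C + 1 by apply: ltr_wpDl.
near=> x; apply: le_lt_trans (fC _ _) _.
apply: (@le_lt_trans _ _ ((C + 1) * `|d - x|)).
  by rewrite ler_wpM2r// lerDl.
rewrite mulrC -ltr_pdivlMr//; near: x.
by move: (@cvg_id _ (nbhs d)) => /cvgrPdist_lt; apply; rewrite divr_gt0.
Unshelve. all: by end_near. Qed.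

Lemma dense_dist (V : normedModType K) (S : set V) (d : V) (e : K) :
  dense S -> 0 < e -> exists2 s, S s & `|d - s| < e.
Proof.
move=> dS e0; have [||s [se sS]] := dS (ball d e).
- by exists d; exact: ballxx.
- exact: ball_open.
by exists s => //; move: se; rewrite -ball_normE.
Qed.

(** The image under [g] of the trace on [S] of the neighborhoods of [d] is a
    Cauchy filter, and [T d] is its limit.  The estimate that carries the proof
    is [|T d - g s| <= |d - s|] for [s] in [S]. *)
Lemma nonexpansive_ext_dense (V : normedModType K) (W : completeNormedModType K)
    (S : set V) (g : V -> W) :
  dense S -> (forall x y, S x -> S y -> `|g x - g y| <= `|x - y|) ->
  exists2 T : V -> W, forall x y, `|T x - T y| <= `|x - y| &
    forall x, S x -> T x = g x.
Proof.
move=> dS gS; pose T (d : V) : W := lim (g @ within S (nbhs d)).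
have near_d (d : V) (e : K) : 0 < e ->
    \forall s \near within S (nbhs d), S s /\ `|d - s| < e.
  move=> e0; have /cvgrPdist_lt/(_ _ e0) := @cvg_id _ (nbhs d).
  by rewrite near_withinE; apply: filterS => s ds Ss.
have Tcvg (d : V) : g @ within S (nbhs d) --> T d.
  have FF := dense_within_proper d dS.
  suff : cauchy_ex (g @ within S (nbhs d)) by move=> /cauchy_exP /cauchy_cvg.
  move=> e e0.
  have [s0 Ss0 ds0] := dense_dist d dS (divr_gt0 e0 (ltr0n _ 2)).
  exists (g s0); rewrite /= /fmap/=.
  apply: filterS (near_d d _ (divr_gt0 e0 (ltr0n _ 2))) => s [Ss ds].
  rewrite /= -ball_normE/=; apply: le_lt_trans (gS _ _ Ss0 Ss) _.
  rewrite -(subrK d s0) -addrA [ltRHS]splitr.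
  by apply: le_lt_trans (ler_normD _ _) _; rewrite distrC ltrD.
have Tg (d s : V) : S s -> `|T d - g s| <= `|d - s|.
  move=> Ss; have FF := dense_within_proper d dS.
  apply/ler_addgt0Pr => e e0; have e20 := divr_gt0 e0 (ltr0n K 2).
  have Tde : \forall s \near within S (nbhs d), `|T d - g s| < e / 2.
    by move/cvgrPdist_lt: (Tcvg d); apply.
  have [t [[St dt] Tt]] := filter_ex (filterI (near_d d _ e20) Tde).
  rewrite -(subrK (g t) (T d)) -addrA; apply: le_trans (ler_normD _ _) _.
  rewrite [e]splitr addrCA; apply: lerD; first exact: ltW.
  apply: le_trans (gS _ _ St Ss) _; rewrite -(subrK d t) -addrA addrC.
  by apply: le_trans (ler_normD _ _) _; rewrite lerD// distrC ltW.
exists T.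
- move=> x y; apply/ler_addgt0Pr => e e0.
  have [s Ss xs] := dense_dist x dS (divr_gt0 e0 (ltr0n _ 2)).
  rewrite -(subrK (g s) (T x)) -addrA; apply: le_trans (ler_normD _ _) _.
  rewrite [e]splitr addrCA; apply: lerD.
    exact: le_trans (Tg _ _ Ss) (ltW xs).
  rewrite distrC; apply: le_trans (Tg _ _ Ss) _.
  rewrite -{1}(subrK x y) -addrA; apply: le_trans (ler_normD _ _) _.
  by rewrite distrC lerD// ltW.
- move=> x Sx; apply/eqP; rewrite -subr_eq0 -normr_le0.
  by apply: le_trans (Tg _ _ Sx) _; rewrite subrr normr0.
Qed.

End DenseSubsets.

Section CStarContinuity.
Context {R : realType} {A : cstarAlgType R}.

Lemma amul_continuousl (a : A) : continuous (fun x : A => a ** x).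
Proof.
apply: (@lipschitz_continuous _ _ _ `|a|) => // x y.
by rewrite -amulBr norm_amul.
Qed.

Lemma amul_continuousr (a : A) : continuous (fun x : A => x ** a).
Proof.
apply: (@lipschitz_continuous _ _ _ `|a|) => // x y.
by rewrite -amulBl mulrC norm_amul.
Qed.

Lemma astar_continuous : continuous (@astar R A).
Proof.
apply: (@lipschitz_continuous _ _ _ 1) => // x y.
by rewrite -astarB norm_astar mul1r.
Qed.

Lemma star_aut_continuous (f : star_aut A) : continuous f.
Proof.
apply: (@lipschitz_continuous _ _ _ 1) => // x y.
by rewrite -scaleN1r addrC -aut_linear norm_star_aut scaleN1r addrC mul1r.
Qed.

End CStarContinuity.

(** * Algebra of multipliers *)

Section Multipliers.
Context {R : realType} {A : cstarAlgType R}.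
Implicit Types (m n : multiplier A) (a b z : R[i]).

(** A C*-algebra has no annihilator: [t = (x - y)^*] already gives
    [|x - y|^2 = 0]. *)
Lemma amul_injl (x y : A) : (forall t, t ** x = t ** y) -> x = y.
Proof.
move=> xy; apply/eqP; rewrite -subr_eq0 -normr_eq0 -sqrf_eq0 -norm_astar_amul.
by rewrite amulBr xy subrr normr0.
Qed.

Lemma amul_injr (x y : A) : (forall t, x ** t = y ** t) -> x = y.
Proof.
move=> xy; apply: (can_inj astarK); apply: amul_injl => t.
by apply: (can_inj astarK); rewrite !astarM !astarK xy.
Qed.

(** Since there are no annihilators, the centralizer identity recovers the right
    half of a multiplier from its left half.  So identities between multipliers
    need to be checked on one side only. *)
Lemma multiplier_ext m n : lmult m =1 lmult n -> m = n.
Proof.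
move=> mn; have {mn}lE : lmult m = lmult n by apply/funext.
have rE : rmult m = rmult n.
  by apply/funext => x; apply: amul_injr => t; rewrite -!mult_centralizer lE.
case: m n lE rE => [lm rm mP] [ln rn nP] /= lE rE.
case: _ / lE nP => nP; case: _ / rE nP => nP.
by congr Multiplier; exact: Prop_irrelevance.
Qed.

Lemma lmultZ m z x : lmult m (z *: x) = z *: lmult m x.
Proof.
by apply: amul_injl => t; rewrite mult_centralizer !amulZr mult_centralizer.
Qed.

Lemma mult_scale1 m : mult_scale 1 m = m.
Proof. by apply: multiplier_ext => x /=; rewrite scale1r. Qed.

Lemma mult_scaleA a b m : mult_scale a (mult_scale b m) = mult_scale (a * b) m.
Proof. by apply: multiplier_ext => x /=; rewrite scalerA. Qed.

Lemma mult_mul_scalel a m n :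
  mult_mul (mult_scale a m) n = mult_scale a (mult_mul m n).
Proof. exact: multiplier_ext. Qed.

Lemma mult_mul_scaler a m n :
  mult_mul m (mult_scale a n) = mult_scale a (mult_mul m n).
Proof. by apply: multiplier_ext => x /=; rewrite lmultZ. Qed.

Lemma mult_adj_scale a m :
  mult_adj (mult_scale a m) = mult_scale a^* (mult_adj m).
Proof. by apply: multiplier_ext => x /=; rewrite astarZ. Qed.

Lemma aut_mult_scale (f : star_aut A) a m :
  aut_mult f (mult_scale a m) = mult_scale a (aut_mult f m).
Proof. by apply: multiplier_ext => x /=; rewrite star_autZ. Qed.

End Multipliers.

(** * The *-algebra of finite sums *)

Lemma unit_neq0 (R : realType) (z : R[i]) : `|z| = 1 -> z != 0.
Proof. by rewrite -normr_eq0 => ->; exact: oner_neq0. Qed.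

Lemma unit_conjV (R : realType) (z : R[i]) : `|z| = 1 -> z^* = z^-1.
Proof.
move=> z1; apply: (mulfI (unit_neq0 z1)).
by rewrite -normCK z1 expr1n divff// unit_neq0.
Qed.

(** Injectivity makes the supports of [F] and [f \o F] equal; hence this also
    holds when the supports are infinite, where both sums are zero by
    convention. *)
Lemma inj_additive_fsum (I : choiceType) (V W : nmodType) (f : V -> W)
    (F : I -> V) :
  f 0 = 0 -> {morph f : x y / x + y} -> injective f ->
  f (\sum_(i \in [set: I]) F i) = \sum_(i \in [set: I]) f (F i).
Proof.
move=> f0 fD f_inj; rewrite (big_morph f fD f0); congr (\big[_/_]_(i <- _) _).
rewrite /finite_support !unlock; congr (finmap.enum_fset (fset_set _)).
apply/seteqP; split=> i /= [_ Fi]; split=> //.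
  by move=> fFi; apply: Fi; apply: f_inj; rewrite f0.
by move=> Fi0; apply: Fi; rewrite /= Fi0.
Qed.

Section TwistedAlgebra.
Context {R : realType} {K : groupType} {B : cstarAlgType R}.
Context (c : K -> K -> R[i]) (pi : K -> star_aut B).
Context (c_cochain : cochain2 c).
Context (c_cocycle : forall k l n : K,
  c k l * c (k * l)%g n = c l n * c k (l * n)%g).
Context (piM : forall (k l : K) b, pi (k * l)%g b = pi k (pi l b)).
Implicit Types (x y xi : K -> B) (k l n : K).

Let norm_c k l : `|c k l| = 1. Proof. by case: c_cochain. Qed.
Let c1l k : c 1%g k = 1. Proof. by case: c_cochain. Qed.
Let c1r k : c k 1%g = 1. Proof. by case: c_cochain. Qed.

Let c_neq0 k l : c k l != 0. Proof. exact: unit_neq0. Qed.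

Lemma pi1 b : pi 1%g b = b.
Proof. by apply: (can_inj (aut_funK (pi 1%g))); rewrite -piM mulg1. Qed.

(** The coefficients of [u_k x]: [u_k (x(l) u_l) = c(k,l) pi_k(x(l)) u_(kl)]. *)
Definition left_translate k x : K -> B :=
  fun l => c k (k^-1 * l)%g *: pi k (x (k^-1 * l)%g).

(** The coefficients of [x u_k]: [(x(l) u_l) u_k = c(l,k) x(l) u_(lk)]. *)
Definition right_translate k x : K -> B :=
  fun l => c (l * k^-1)%g k *: x (l * k^-1)%g.

Lemma finsupp_comp_inj (f : K -> K) (g : K -> B -> B) x : injective f ->
  (forall k, g k 0 = 0) -> finsupp x -> finsupp (fun k => g k (x (f k))).
Proof.
move=> f_inj g0 fx.
have := finite_preimage (in2W f_inj : {in _ &, injective f}) fx.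
apply: sub_finite_set => k /=.
by apply: contra_neq => ->.
Qed.

Lemma finsupp_left_translate k x : finsupp x -> finsupp (left_translate k x).
Proof.
apply: (@finsupp_comp_inj _ (fun l b => c k (k^-1 * l)%g *: pi k b)).
  exact: mulgI.
by move=> l; rewrite star_aut0 scaler0.
Qed.

Lemma finsupp_right_translate k x : finsupp x -> finsupp (right_translate k x).
Proof.
apply: (@finsupp_comp_inj _ (fun l b => c (l * k^-1)%g k *: b)).
  exact: mulIg.
by move=> l; rewrite scaler0.
Qed.

Lemma finsupp_twisted_mul x y :
  finsupp x -> finsupp y -> finsupp (twisted_mul c pi x y).
Proof.
move=> fx fy.
apply: sub_finite_set (finite_image2 (fun k l => (k * l)%g) fx fy).
move=> n /= /eqP xyn; apply: contrapT => nxy; apply: xyn.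
apply: fsbig1 => k _.
have [->|xk] := eqVneq (x k) 0; first by rewrite amul0l scaler0.
have [->|yk] := eqVneq (y (k^-1 * n)%g) 0.
  by rewrite star_aut0 amul0r scaler0.
case: nxy; exists k => //; exists (k^-1 * n)%g => //.
by rewrite mulVKg.
Qed.

(** [u_k (x y) = (u_k x) y].  Term by term, this is the cocycle identity. *)
Lemma left_translate_mul k x y :
  left_translate k (twisted_mul c pi x y) =
  twisted_mul c pi (left_translate k x) y.
Proof.
apply/funext => m; rewrite /left_translate /twisted_mul.
rewrite (inj_additive_fsum _ (star_aut0 _) (star_autD _) (@star_aut_inj _ _ _)).
rewrite (inj_additive_fsum _ (scaler0 _ _) (scalerDr _)
           (scalerI (c_neq0 _ _))).
rewrite [RHS](reindex_fsbigT (fun l => k * l)%g); last first.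
  by exists (fun l => k^-1 * l)%g; [exact: mulKg | exact: mulVKg].
apply: eq_fsbigr => l _ /=.
rewrite mulKg star_autZ aut_mul amulZl -piM !scalerA; congr (_ *: _).
rewrite [RHS]mulrC invgM -mulgA c_cocycle mulrC mulVKg //.
by rewrite invgM mulgA.
Qed.

(** [x (u_k y) = (x u_k) y]: on finite sums, [left_translate k] and
    [right_translate k] form a double centralizer. *)
Lemma twisted_mul_left_translate k x y :
  twisted_mul c pi x (left_translate k y) =
  twisted_mul c pi (right_translate k x) y.
Proof.
apply/funext => m; rewrite /left_translate /right_translate /twisted_mul.
rewrite [RHS](reindex_fsbigT (fun l => l * k)%g); last first.
  by exists (fun l => l * k^-1)%g; [exact: mulgK | exact: mulgVK].
apply: eq_fsbigr => l _ /=.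
rewrite mulgK star_autZ amulZr amulZl -piM !scalerA invgM mulgA; congr (_ *: _).
by rewrite [RHS]mulrC -!mulgA c_cocycle mulVKg mulrC.
Qed.

Lemma c_invC k : c k^-1%g k = c k k^-1%g.
Proof.
by have := c_cocycle k k^-1%g k; rewrite mulgV mulVg c1l c1r !mulr1.
Qed.

(** [(x^* u_k)^* = u_k^* x], combined with [u_k^* = c(k^-1,k)^-1 u_(k^-1)]. *)
Lemma astar_right_translate k x :
  twisted_astar c pi (right_translate k (twisted_astar c pi x)) =
  fun l => (c k^-1%g k)^-1 *: left_translate k^-1%g x l.
Proof.
apply/funext => m; rewrite /twisted_astar /right_translate /left_translate.
rewrite !(astarZ, star_autZ) !scalerA -aut_astar astarK invgM !invgK -!piM.
rewrite mulVKg conjCK !unit_conjV// -c_invC; congr (_ *: _).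
have E1 := c_cocycle m^-1%g k^-1%g (k * m)%g; rewrite mulKg in E1.
have E2 := c_cocycle m^-1%g k^-1%g k; rewrite mulVg c1r mulr1 in E2.
apply: (mulfI (c_neq0 m^-1%g k^-1%g)).
rewrite mulrCA [X in _ * X]mulrCA E1 -E2.
by field; rewrite !c_neq0.
Qed.

Lemma left_translate_lincomb k (z : R[i]) x y :
  left_translate k (fun l => z *: x l + y l) =
  fun l => z *: left_translate k x l + left_translate k y l.
Proof.
apply/funext => l; rewrite /left_translate aut_linear scalerDr !scalerA.
by rewrite mulrC.
Qed.

Lemma right_translate_lincomb k (z : R[i]) x y :
  right_translate k (fun l => z *: x l + y l) =
  fun l => z *: right_translate k x l + right_translate k y l.
Proof.
by apply/funext => l; rewrite /right_translate scalerDr !scalerA mulrC.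
Qed.

Lemma finsupp_twisted_astar x : finsupp x -> finsupp (twisted_astar c pi x).
Proof.
apply: (@finsupp_comp_inj _ (fun k b => (c k k^-1%g)^* *: pi k (astar b))).
  exact: invg_inj.
by move=> k; rewrite astar0 star_aut0 scaler0.
Qed.

(** The data from which [b u_k |-> sym_phase k (sym_base b) u_(sym_map k)] is
    an automorphism of the *-algebra of finite sums.  Conjugation by [u_g],
    with [g] in a group that contains [K] as a normal subgroup, has this form.
    The inverse of [sym_map] is part of the data because coefficients are
    transported backwards. *)
Record crossed_symmetry := CrossedSymmetry {
  sym_map : K -> K;
  sym_inv : K -> K;
  sym_mapK : cancel sym_map sym_inv;
  sym_invK : cancel sym_inv sym_map;
  sym_mapM : forall k l, sym_map (k * l)%g = (sym_map k * sym_map l)%g;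
  sym_base : star_aut B;
  sym_phase : K -> R[i];
  sym_phase_norm : forall k, `|sym_phase k| = 1;
  sym_covariant : forall k b, sym_base (pi k b) = pi (sym_map k) (sym_base b);
  sym_phaseM : forall k l,
    sym_phase k * sym_phase l * c (sym_map k) (sym_map l) =
    sym_phase (k * l)%g * c k l
}.

Definition sym_act (s : crossed_symmetry) x : K -> B :=
  fun k => sym_phase s (sym_inv s k) *: sym_base s (x (sym_inv s k)).

Lemma sym_map1 s : sym_map s 1%g = 1%g.
Proof. by apply: (@mulgI _ (sym_map s 1%g)); rewrite -sym_mapM !mulg1. Qed.

Lemma sym_mapV s k : sym_map s k^-1%g = (sym_map s k)^-1%g.
Proof.
by apply: (@mulgI _ (sym_map s k)); rewrite -sym_mapM !mulgV sym_map1.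
Qed.

Lemma sym_invM s k l : sym_inv s (k * l)%g = (sym_inv s k * sym_inv s l)%g.
Proof. by apply: (can_inj (sym_mapK s)); rewrite sym_mapM !sym_invK. Qed.

Lemma sym_invV s k : sym_inv s k^-1%g = (sym_inv s k)^-1%g.
Proof. by apply: (can_inj (sym_mapK s)); rewrite sym_mapV !sym_invK. Qed.

Lemma sym_phase_neq0 s k : sym_phase s k != 0.
Proof. exact/unit_neq0/sym_phase_norm. Qed.

Lemma sym_phase1 s : sym_phase s 1%g = 1.
Proof.
apply: (mulfI (sym_phase_neq0 s 1%g)).
by have := sym_phaseM s 1%g 1%g; rewrite sym_map1 mulg1 c1l !mulr1.
Qed.

Lemma finsupp_sym_act s x : finsupp x -> finsupp (sym_act s x).
Proof.
apply: (@finsupp_comp_inj _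
          (fun k b => sym_phase s (sym_inv s k) *: sym_base s b)).
  exact: can_inj (sym_invK s).
by move=> k; rewrite star_aut0 scaler0.
Qed.

Lemma sym_act_lincomb s (z : R[i]) x y :
  sym_act s (fun k => z *: x k + y k) =
  fun k => z *: sym_act s x k + sym_act s y k.
Proof.
apply/funext => k; rewrite /sym_act aut_linear scalerDr !scalerA.
by rewrite mulrC.
Qed.

Lemma sym_act_mul s x y :
  sym_act s (twisted_mul c pi x y) =
  twisted_mul c pi (sym_act s x) (sym_act s y).
Proof.
apply/funext => m; rewrite /sym_act /twisted_mul.
rewrite (inj_additive_fsum _ (star_aut0 _) (star_autD _) (@star_aut_inj _ _ _)).
rewrite (inj_additive_fsum _ (scaler0 _ _) (scalerDr _)
           (scalerI (sym_phase_neq0 _ _))).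
rewrite [RHS](reindex_fsbigT (sym_map s)); last first.
  by exists (sym_inv s); [exact: sym_mapK | exact: sym_invK].
apply: eq_fsbigr => l _ /=.
rewrite -sym_mapV sym_invM !sym_mapK star_autZ aut_mul sym_covariant.
rewrite star_autZ amulZl amulZr !scalerA; congr (_ *: _).
have := sym_phaseM s l (l^-1 * sym_inv s m)%g.
by rewrite mulVKg => <-; rewrite sym_mapM sym_invK; ring.
Qed.

(** The phases match by [sym_phaseM] at [k] and [k^-1], as
    [sym_phase s 1 = 1]. *)
Lemma sym_act_astar s x :
  sym_act s (twisted_astar c pi x) = twisted_astar c pi (sym_act s x).
Proof.
apply/funext => m; rewrite /sym_act /twisted_astar.
rewrite !star_autZ astarZ star_autZ sym_covariant sym_invK aut_astar sym_invV.
rewrite !scalerA; congr (_ *: _).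
rewrite !unit_conjV ?sym_phase_norm//.
have := sym_phaseM s (sym_inv s m) (sym_inv s m)^-1%g.
rewrite sym_mapV sym_invK mulgV sym_phase1 mul1r => <-.
by field; rewrite !sym_phase_neq0 c_neq0.
Qed.

Lemma sym_act_left_translate s k x :
  sym_act s (left_translate k x) =
  fun l => sym_phase s k *: left_translate (sym_map s k) (sym_act s x) l.
Proof.
apply/funext => m; rewrite /sym_act /left_translate.
rewrite !star_autZ sym_covariant !scalerA -sym_mapV sym_invM sym_mapK.
congr (_ *: _); have := sym_phaseM s k (k^-1 * sym_inv s m)%g.
by rewrite mulVKg => <-; rewrite sym_mapM sym_invK; ring.
Qed.

Definition sym_inverse (s : crossed_symmetry) : crossed_symmetry.
Proof.
apply: (@CrossedSymmetry (sym_inv s) (sym_map s) (sym_invK s) (sym_mapK s)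
  (sym_invM s) (star_aut_inv (sym_base s))
  (fun k => (sym_phase s (sym_inv s k))^-1)).
- by move=> k; rewrite normfV sym_phase_norm invr1.
- move=> k b; apply: (can_inj (aut_funK (sym_base s))).
  by rewrite sym_covariant /= !aut_invK sym_invK.
- move=> k l; have := sym_phaseM s (sym_inv s k) (sym_inv s l).
  rewrite !sym_invK sym_invM => E.
  apply: (mulfI (sym_phase_neq0 s (sym_inv s k * sym_inv s l)%g)).
  rewrite [RHS]mulrA divff ?sym_phase_neq0// mul1r.
  rewrite mulrCA -E.
  by field; rewrite !sym_phase_neq0.
Defined.

Lemma sym_actK s x : sym_act (sym_inverse s) (sym_act s x) = x.
Proof.
apply/funext => k; rewrite /sym_act star_autZ /= sym_mapK aut_funK scalerA.
by rewrite mulVf ?scale1r// sym_phase_neq0.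
Qed.

Lemma sym_act_invK s x : sym_act s (sym_act (sym_inverse s) x) = x.
Proof.
apply/funext => k; rewrite /sym_act /= sym_invK star_autZ aut_invK scalerA.
by rewrite mulfV ?scale1r// sym_phase_neq0.
Qed.

(** * Norm estimates in the regular representation *)

(** A vector [xi] of [l^2(K,B)] stands for the sum of the [u_l xi(l)], while an
    element of the algebra is written as a sum of terms [y(l) u_l].  As [u_l b
    = pi_l(b) u_l], the vector corresponds to [y(l) = pi_l(xi(l))], and the
    regular representation becomes left multiplication.  The identities already
    known in the algebra then apply to the regular representation. *)
Lemma regular_repE x xi :
  regular_rep c pi x xi =
  fun l => pi l^-1%g (twisted_mul c pi x (fun k => pi k (xi k)) l).
Proof.
apply/funext => l; rewrite /regular_rep /twisted_mul.
rewrite (inj_additive_fsum _ (star_aut0 _) (star_autD _) (@star_aut_inj _ _ _)).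
apply: eq_fsbigr => k _ /=.
by rewrite star_autZ aut_mul amulZr -!piM -mulgA mulVKg mulVg pi1.
Qed.

(** Acting by [s] commutes with the passage [xi |-> y] of [regular_repE], by
    covariance; so this is the multiplicativity of [sym_act s]. *)
Lemma sym_act_regular_rep s x xi :
  regular_rep c pi (sym_act s x) (sym_act s xi) =
  sym_act s (regular_rep c pi x xi).
Proof.
rewrite !regular_repE; apply/funext => l.
have -> : (fun k => pi k (sym_act s xi k)) = sym_act s (fun k => pi k (xi k)).
  apply/funext => k; rewrite /sym_act star_autZ sym_covariant.
  by rewrite sym_invK.
rewrite -sym_act_mul /sym_act star_autZ sym_covariant.
by rewrite sym_mapV sym_invK.
Qed.

(** The inner product of [l^2(K,B)] is transported by [sym_base s], and
    *-automorphisms of [B] are isometric. *)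
Lemma l2norm_sym_act s xi : l2norm (sym_act s xi) = l2norm xi.
Proof.
rewrite /l2norm; congr Num.sqrt.
rewrite (reindex_fsbigT (sym_map s)); last first.
  by exists (sym_inv s); [exact: sym_mapK | exact: sym_invK].
rewrite (_ : \sum_(k \in [set: K]) _ =
    sym_base s (\sum_(k \in [set: K]) astar (xi k) ** xi k)).
  by rewrite /rnorm norm_star_aut.
rewrite (inj_additive_fsum _ (star_aut0 _) (star_autD _) (@star_aut_inj _ _ _)).
apply: eq_fsbigr => k _ /=; rewrite /sym_act sym_mapK aut_mul aut_astar.
rewrite astarZ amulZl amulZr scalerA mulrC -normCK.
by rewrite sym_phase_norm expr1n scale1r.
Qed.

Lemma reduced_norm_le x y (S : (K -> B) -> (K -> B)) :
  (forall xi, finsupp xi -> finsupp (S xi)) ->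
  (forall xi, l2norm (S xi) = l2norm xi) ->
  (forall xi,
    l2norm (regular_rep c pi x xi) = l2norm (regular_rep c pi y (S xi))) ->
  (reduced_norm c pi x <= reduced_norm c pi y)%E.
Proof.
move=> Sfin Snorm Sxy; apply: ge_ereal_sup => _ [xi [fxi nxi] <-].
apply: ereal_sup_ubound; exists (S xi); last by rewrite Sxy.
by split; [exact: Sfin | rewrite Snorm].
Qed.

Lemma reduced_norm_sym_act s x :
  (reduced_norm c pi (sym_act s x) <= reduced_norm c pi x)%E.
Proof.
apply: (reduced_norm_le (S := sym_act (sym_inverse s))).
- by move=> xi; exact: finsupp_sym_act.
- by move=> xi; exact: l2norm_sym_act.
move=> xi; rewrite -[RHS](l2norm_sym_act s) -sym_act_regular_rep.
by rewrite sym_act_invK.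
Qed.

(** The unitary of [l^2(K,B)] given by left multiplication by [u_k]. *)
Let untwisted_left_translate k x :
  (fun l => pi l^-1%g (left_translate k (fun k => pi k (x k)) l)) =
  fun l => c k (k^-1 * l)%g *: x (k^-1 * l)%g.
Proof.
apply/funext => l; rewrite /left_translate star_autZ -!piM.
by rewrite -mulgA mulVKg mulVg pi1.
Qed.

Let l2norm_shift k xi :
  l2norm (fun l => c k (k^-1 * l)%g *: xi (k^-1 * l)%g) = l2norm xi.
Proof.
rewrite /l2norm (reindex_fsbigT (fun l => k * l)%g); last first.
  by exists (fun l => k^-1 * l)%g; [exact: mulKg | exact: mulVKg].
congr (Num.sqrt (rnorm _)); apply: eq_fsbigr => l _ /=.
rewrite mulKg astarZ amulZl amulZr scalerA mulrC -normCK.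
by rewrite norm_c expr1n scale1r.
Qed.

(** The operator of [u_k x] is that of [x] followed by a unitary. *)
Lemma reduced_norm_left_translate k x :
  (reduced_norm c pi (left_translate k x) <= reduced_norm c pi x)%E.
Proof.
apply: (reduced_norm_le (S := id)) => // xi.
rewrite -[RHS](l2norm_shift k) -untwisted_left_translate !regular_repE.
rewrite -left_translate_mul; congr l2norm; apply/funext => l.
congr (pi _ (left_translate _ _ _)); apply/funext => n.
by rewrite -piM mulgV pi1.
Qed.

(** The operator of [x u_k] is that of [x] preceded by a unitary. *)
Lemma reduced_norm_right_translate k x :
  (reduced_norm c pi (right_translate k x) <= reduced_norm c pi x)%E.
Proof.
apply: (reduced_norm_le
  (S := fun xi l => c k (k^-1 * l)%g *: xi (k^-1 * l)%g)) => xi.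
- apply: (@finsupp_comp_inj _ (fun l b => c k (k^-1 * l)%g *: b)).
    exact: mulgI.
  by move=> l; rewrite scaler0.
- exact: l2norm_shift.
rewrite /= -untwisted_left_translate !regular_repE.
rewrite -twisted_mul_left_translate.
congr l2norm; apply/funext => l; congr (pi _ (twisted_mul _ _ _ _ _)).
by apply/funext => n; rewrite -piM mulgV pi1.
Qed.

(** If [s] is conjugation by [u_k], then [u_k x = s(x) u_k].  The hypothesis on
    the phase is the coefficient in [u_k u_n = sym_phase(n) u_(k n k^-1)
    u_k]. *)
Lemma inner_translate s k x :
  (forall n, sym_map s n = (k * n * k^-1)%g) ->
  (forall b, sym_base s b = pi k b) ->
  (forall n, sym_phase s n * c (k * n * k^-1)%g k = c k n) ->
  left_translate k x = right_translate k (sym_act s x).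
Proof.
move=> sE bE pE; apply/funext => l.
have siE n : sym_inv s n = (k^-1 * n * k)%g.
  apply: (can_inj (sym_mapK s)).
  by rewrite sym_invK sE !mulgA mulgV mul1g mulgK.
rewrite /right_translate /sym_act bE siE mulgA mulgVK scalerA.
congr (_ *: _); rewrite -pE mulrC.
by rewrite mulVKg.
Qed.

(** * Automorphisms and multipliers of the crossed product *)

Context (D : reduced_crossed_product c pi).
Notation incl := (@rcp_incl _ _ _ _ _ D).

Lemma finsupp_lincomb (z : R[i]) x y :
  finsupp x -> finsupp y -> finsupp (fun k => z *: x k + y k).
Proof.
move=> fx fy; have : finite_set ([set k | x k != 0] `|` [set k | y k != 0]).
  by rewrite finite_setU; split.
apply: sub_finite_set => k /=.
have [->|xk] := eqVneq (x k) 0; last by left.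
have [->|yk] := eqVneq (y k) 0; last by right.
by rewrite scaler0 addr0 eqxx.
Qed.

Lemma incl_le x y : finsupp x -> finsupp y ->
  (reduced_norm c pi x <= reduced_norm c pi y)%E -> `|incl x| <= `|incl y|.
Proof.
move=> fx fy; rewrite -!(@rcp_norm _ _ _ _ _ D)// lee_fin -lecR /rnorm.
by rewrite !RRe_real// ger0_real.
Qed.

Lemma eq_on_crossed_product (W : normedModType R[i]) (f g : D -> W) :
  continuous f -> continuous g ->
  (forall x, finsupp x -> f (incl x) = g (incl x)) ->
  forall d, f d = g d.
Proof.
move=> fc gc fg; apply: (continuous_eq_dense (@rcp_dense _ _ _ _ _ D) fc gc).
by move=> _ /set_mem [x fx <-]; exact: fg.
Qed.

(** [incl] need not be injective, so an element of its range does not determine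
    the finite sum it comes from.  This is harmless: [T] does not increase the
    norm of differences, so sums with the same image are mapped to sums with the
    same image. *)
Lemma crossed_product_ext (T : (K -> B) -> (K -> B)) :
  (forall x, finsupp x -> finsupp (T x)) ->
  (forall (z : R[i]) x y,
    T (fun k => z *: x k + y k) = fun k => z *: T x k + T y k) ->
  (forall x, (reduced_norm c pi (T x) <= reduced_norm c pi x)%E) ->
  {f : D -> D | continuous f & forall x, finsupp x -> f (incl x) = incl (T x)}.
Proof.
move=> Tfin Tlin Tle; apply/cid2.
pose S := incl @` @finsupp K B.
have /choice[pre preP] : forall d : D, exists x, S d -> finsupp x /\ incl x = d.
  move=> d; have [[x fx xd]|nd] := pselect (S d); first by exists x.
  by exists (fun=> 0) => /nd.
have diff u v : finsupp u -> finsupp v ->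
    incl u - incl v = incl (fun k => -1 *: v k + u k).
  by move=> fu fv; rewrite rcp_linear// scaleN1r addrC.
have Tnonexp u v : finsupp u -> finsupp v ->
    `|incl (T u) - incl (T v)| <= `|incl u - incl v|.
  move=> fu fv; rewrite !diff//; try exact: Tfin.
  rewrite -Tlin; have fuv := finsupp_lincomb (-1) fv fu.
  by apply: incl_le => //; exact: Tfin.
have [|f f1 fS] := @nonexpansive_ext_dense _ D D S (fun d => incl (T (pre d)))
    (@rcp_dense _ _ _ _ _ D).
  move=> d e Sd Se; have [[fd dE] [fe eE]] := (preP _ Sd, preP _ Se).
  by rewrite -{2}dE -{2}eE Tnonexp.
exists f.
  by apply: (lipschitz_continuous ler01) => d e; rewrite mul1r.
move=> x fx; have Sx : S (incl x) by exists x.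
have [fp pE] := preP _ Sx; rewrite fS//.
apply/eqP; rewrite -subr_eq0 -normr_le0.
by apply: le_trans (Tnonexp _ _ fp fx) _; rewrite pE subrr normr0.
Qed.
Let affine_continuous (f : D -> D) (z : R[i]) (e : D) :
  continuous f -> continuous (fun d => z *: f d + e).
Proof.
move=> fc d; apply: cvgD; last exact: cvg_cst.
by apply: cvgZr; exact: fc.
Qed.

Let comp_continuous (f g : D -> D) :
  continuous f -> continuous g -> continuous (fun d => f (g d)).
Proof. by move=> fc gc d; apply: continuous_comp; [exact: gc | exact: fc]. Qed.

(** The extensions of [s] and of its inverse are inverse to each other by
    density, and linearity, multiplicativity and compatibility with the adjoint
    pass to the completion one variable at a time. *)
Definition crossed_aut_sig s :
  {a : star_aut D | forall x, finsupp x -> a (incl x) = incl (sym_act s x)}.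
Proof.
have ext u := crossed_product_ext (@finsupp_sym_act u) (sym_act_lincomb u)
  (reduced_norm_sym_act u).
have [f fc fE] := ext s; have [g gc gE] := ext (sym_inverse s).
have fg : cancel f g.
  apply: eq_on_crossed_product; first exact: comp_continuous.
    by move=> d; exact: cvg_id.
  by move=> x fx; rewrite fE// gE ?sym_actK//; exact: finsupp_sym_act.
have gf : cancel g f.
  apply: eq_on_crossed_product; first exact: comp_continuous.
    by move=> d; exact: cvg_id.
  by move=> x fx; rewrite gE// fE ?sym_act_invK//; exact: finsupp_sym_act.
have flin (z : R[i]) (d e : D) : f (z *: d + e) = z *: f d + f e.
  move: d; apply: eq_on_crossed_product => [||x fx].
  - apply: comp_continuous => //.
    by apply: affine_continuous => d; exact: cvg_id.
  - exact: affine_continuous.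
  move: e; apply: eq_on_crossed_product => [||y fy].
  - apply: comp_continuous => // d.
    by apply: cvgD; [exact: cvg_cst | exact: cvg_id].
  - by move=> d; apply: cvgD; [exact: cvg_cst | exact: fc].
  rewrite -rcp_linear// fE; last exact: finsupp_lincomb.
  by rewrite sym_act_lincomb rcp_linear ?fE//; exact: finsupp_sym_act.
have fM (d e : D) : f (d ** e) = f d ** f e.
  move: d; apply: eq_on_crossed_product => [||x fx].
  - by apply: comp_continuous => //;
      exact: amul_continuousr.
  - by apply: (@comp_continuous (fun d => d ** f e)) => //;
      exact: amul_continuousr.
  move: e; apply: eq_on_crossed_product => [||y fy].
  - by apply: comp_continuous => //;
      exact: amul_continuousl.
  - by apply: (@comp_continuous (fun e => _ ** e)) => //;
      exact: amul_continuousl.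
  rewrite -rcp_mul// fE; last exact: finsupp_twisted_mul.
  by rewrite sym_act_mul rcp_mul ?fE//; exact: finsupp_sym_act.
have fstar (d : D) : f (astar d) = astar (f d).
  move: d; apply: eq_on_crossed_product => [||x fx].
  - by apply: comp_continuous => //; exact: astar_continuous.
  - by apply: comp_continuous => //; exact: astar_continuous.
  rewrite -rcp_astar// fE; last exact: finsupp_twisted_astar.
  by rewrite sym_act_astar rcp_astar ?fE//; exact: finsupp_sym_act.
by exists (StarAut fg gf flin fM fstar).
Qed.

Definition translation_sig k :
  {m : multiplier D | continuous (lmult m) /\ continuous (rmult m) &
    forall x, finsupp x -> lmult m (incl x) = incl (left_translate k x) /\
                           rmult m (incl x) = incl (right_translate k x)}.
Proof.
have [f fc fE] := crossed_product_ext (@finsupp_left_translate k)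
  (left_translate_lincomb k) (reduced_norm_left_translate k).
have [g gc gE] := crossed_product_ext (@finsupp_right_translate k)
  (right_translate_lincomb k) (reduced_norm_right_translate k).
have fg (d e : D) : d ** f e = g d ** e.
  move: d; apply: eq_on_crossed_product => [||x fx].
  - exact: amul_continuousr.
  - by apply: (@comp_continuous (fun d => d ** e)) => //;
      exact: amul_continuousr.
  move: e; apply: eq_on_crossed_product => [||y fy].
  - by apply: (@comp_continuous (fun e => _ ** e)) => //;
      exact: amul_continuousl.
  - exact: amul_continuousl.
  rewrite fE// gE// -rcp_mul//; last exact: finsupp_left_translate.
  rewrite twisted_mul_left_translate rcp_mul//.
  exact: finsupp_right_translate.
by exists (Multiplier fg) => //= x fx; rewrite fE// gE.
Qed.
Lemma inclZ (z : R[i]) x : finsupp x -> incl (fun k => z *: x k) = z *: incl x.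
Proof.
have f0 : finsupp ((fun=> 0) : K -> B).
  by apply: sub_finite_set (finite_set0 K) => k /=; rewrite eqxx.
have incl0 : incl (fun=> 0) = 0.
  have E := rcp_linear D (-1) f0 f0.
  rewrite [in RHS]scaleN1r [in RHS]addNr in E; rewrite -[RHS]E.
  by congr (rcp_incl _ _); apply/funext => k; rewrite scaler0 addr0.
move=> fx; have := rcp_linear D z fx f0; rewrite incl0 addr0 => <-.
by congr (rcp_incl _ _); apply/funext => k; rewrite addr0.
Qed.

Definition crossed_aut s : star_aut D := sval (crossed_aut_sig s).

Lemma crossed_autE s x :
  finsupp x -> crossed_aut s (incl x) = incl (sym_act s x).
Proof. exact: (svalP (crossed_aut_sig s)). Qed.

(** The unitary [u_k], as a multiplier of the completion. *)
Definition translation k : multiplier D := s2val (translation_sig k).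

Lemma lmult_translation_continuous k : continuous (lmult (translation k)).
Proof. by case: (s2valP (translation_sig k)). Qed.

Lemma rmult_translation_continuous k : continuous (rmult (translation k)).
Proof. by case: (s2valP (translation_sig k)). Qed.

Lemma lmult_translation k x : finsupp x ->
  lmult (translation k) (incl x) = incl (left_translate k x).
Proof. by move=> /(@s2valP' _ _ _ (translation_sig k))[]. Qed.

Lemma rmult_translation k x : finsupp x ->
  rmult (translation k) (incl x) = incl (right_translate k x).
Proof. by move=> /(@s2valP' _ _ _ (translation_sig k))[]. Qed.

Let scale_continuous (f : D -> D) (z : R[i]) :
  continuous f -> continuous (fun d => z *: f d).
Proof. by move=> fc d; apply: cvgZr; exact: fc. Qed.

Lemma translation1 : translation 1%g = mult_one D.
Proof.
apply: multiplier_ext; apply: eq_on_crossed_product => [||x fx].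
- exact: lmult_translation_continuous.
- by move=> d; exact: cvg_id.
rewrite lmult_translation//; congr (rcp_incl _ _); apply/funext => k.
by rewrite /left_translate invg1 mul1g c1l scale1r pi1.
Qed.

Lemma translationM k l : mult_mul (translation k) (translation l) =
  mult_scale (c k l) (translation (k * l)%g).
Proof.
apply: multiplier_ext; apply: eq_on_crossed_product => [||x fx] /=.
- by apply: comp_continuous; exact: lmult_translation_continuous.
- by apply: scale_continuous; exact: lmult_translation_continuous.
have flx := finsupp_left_translate l fx.
have fklx := finsupp_left_translate (k * l)%g fx.
rewrite !lmult_translation// -inclZ//; congr (rcp_incl _ _); apply/funext => m.
rewrite /left_translate star_autZ -!piM !scalerA invgM mulgA; congr (_ *: _).
have := c_cocycle k l (l^-1 * k^-1 * m)%g.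
by rewrite -mulgA mulVKg => ->; rewrite mulrC.
Qed.

Lemma mult_adj_translation k : mult_adj (translation k) =
  mult_scale (c k^-1%g k)^-1 (translation k^-1%g).
Proof.
apply: multiplier_ext; apply: eq_on_crossed_product => [||x fx] /=.
- apply: comp_continuous; first exact: astar_continuous.
  apply: comp_continuous; last exact: astar_continuous.
  exact: rmult_translation_continuous.
- by apply: scale_continuous; exact: lmult_translation_continuous.
have fsx := finsupp_twisted_astar fx.
rewrite lmult_translation// -rcp_astar// rmult_translation//.
rewrite -rcp_astar ?astar_right_translate; last exact: finsupp_right_translate.
by rewrite inclZ//; exact: finsupp_left_translate.
Qed.

Lemma scaled_translation_unitary (z : R[i]) k : `|z| = 1 ->
  mult_unitary (mult_scale z (translation k)).
Proof.
move=> z1; rewrite /mult_unitary mult_adj_scale mult_adj_translation.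
rewrite !mult_mul_scalel !mult_mul_scaler !translationM mulVg mulgV.
rewrite translation1.
rewrite !mult_scaleA -c_invC unit_conjV//.
split; rewrite -[RHS]mult_scale1; congr mult_scale; field.
  by rewrite c_neq0 unit_neq0.
by rewrite c_neq0 unit_neq0.
Qed.

Lemma aut_mult_translation s k : aut_mult (crossed_aut s) (translation k) =
  mult_scale (sym_phase s k) (translation (sym_map s k)).
Proof.
apply: multiplier_ext => d /=; rewrite -{2}(aut_invK (crossed_aut s) d).
move: (aut_inv _ _) => {}d; move: d.
apply: eq_on_crossed_product => [||x fx] /=.
- by apply: comp_continuous;
    [exact: star_aut_continuous | exact: lmult_translation_continuous].
- apply/scale_continuous/comp_continuous; last exact: star_aut_continuous.
  exact: lmult_translation_continuous.
have fsx := finsupp_sym_act s fx; have fkx := finsupp_left_translate k fx.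
rewrite lmult_translation// !crossed_autE// lmult_translation//.
by rewrite sym_act_left_translate inclZ//; exact: finsupp_left_translate.
Qed.

(** [u_k d u_k^* = s(d)] when [s] is conjugation by [u_k]; the formulation
    without inverses is the one that extends from [inner_translate] by
    density. *)
Lemma translation_inner s k d :
  (forall n, sym_map s n = (k * n * k^-1)%g) ->
  (forall b, sym_base s b = pi k b) ->
  (forall n, sym_phase s n * c (k * n * k^-1)%g k = c k n) ->
  lmult (translation k) d = rmult (translation k) (crossed_aut s d).
Proof.
move=> sE bE pE; move: d; apply: eq_on_crossed_product => [||x fx].
- exact: lmult_translation_continuous.
- apply: comp_continuous; last exact: star_aut_continuous.
  exact: rmult_translation_continuous.
have fsx := finsupp_sym_act s fx.
rewrite lmult_translation// crossed_autE// rmult_translation//.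
by rewrite (inner_translate x sE bE pE).
Qed.

Lemma crossed_aut_comp s t u d :
  (forall x, sym_act s (sym_act t x) = sym_act u x) ->
  crossed_aut s (crossed_aut t d) = crossed_aut u d.
Proof.
move=> stu; move: d; apply: eq_on_crossed_product => [||x fx].
- by apply: comp_continuous; exact: star_aut_continuous.
- exact: star_aut_continuous.
have ftx := finsupp_sym_act t fx.
by rewrite !crossed_autE// stu.
Qed.

End TwistedAlgebra.

(** * The extension of Q by K and its anomaly *)

Section GroupExtension.
Context {R : realType} {Q G : groupType} {omega : Q -> Q -> Q -> R[i]}.
Context (rho : {multiplicative G -> Q}) (c : G -> G -> R[i]).
Context {B : cstarAlgType R} (pi : G -> star_aut B).
Context (omega_cochain : cochain3 omega) (c_cochain : cochain2 c).
Context (dc : forall f g h, coboundary2 c f g h = pullback3 rho omega f g h).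
Context (piM : forall g h b, pi (g * h)%g b = pi g (pi h b)).
Implicit Types (f g h : G) (k l : group_ker rho).

Let c_neq0 f g : c f g != 0.
Proof. by case: c_cochain => c1 _ _; exact: unit_neq0. Qed.

(** [(u_f u_g) u_h = omega(rho f, rho g, rho h) u_f (u_g u_h)]. *)
Lemma twisted_cocycle f g h :
  c f g * c (f * g)%g h =
  omega (rho f) (rho g) (rho h) * (c g h * c f (g * h)%g).
Proof.
rewrite -/(pullback3 rho omega f g h) -dc /coboundary2.
by field; rewrite !c_neq0.
Qed.

(** As [omega] is normalized, there is no associator when one of the three
    indices is in the kernel. *)
Lemma cocycle_kerl k g h :
  c (val k) g * c (val k * g)%g h = c g h * c (val k) (g * h)%g.
Proof.
have [_ [w1 _ _]] := omega_cochain.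
by rewrite twisted_cocycle (eqP (valP k)) w1 mul1r.
Qed.

Lemma cocycle_kerm f k h :
  c f (val k) * c (f * val k)%g h = c (val k) h * c f (val k * h)%g.
Proof.
have [_ [_ w2 _]] := omega_cochain.
by rewrite twisted_cocycle (eqP (valP k)) w2 mul1r.
Qed.

Lemma cocycle_kerr f g k :
  c f g * c (f * g)%g (val k) = c g (val k) * c f (g * val k)%g.
Proof.
have [_ [_ _ w3]] := omega_cochain.
by rewrite twisted_cocycle (eqP (valP k)) w3 mul1r.
Qed.

Lemma valM_ker k l : val (k * l)%g = (val k * val l)%g.
Proof. exact: gmulfM. Qed.

Lemma valV_ker k : val (k^-1)%g = (val k)^-1%g.
Proof. exact: gmulfV. Qed.

Lemma val1_ker : val (1%g : group_ker rho) = 1%g.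
Proof. exact: gmulf1. Qed.

Lemma in_ker_conj g k : in_ker rho (g * val k * g^-1)%g.
Proof.
have rho1 : rho 1%g = 1%g by apply/eqP; case: (in_ker_closed rho).
by apply/eqP; rewrite !gmulfM (eqP (valP k)) mulg1 -gmulfM mulgV.
Qed.

Definition ker_conj g k : group_ker rho :=
  exist (fun h => in_ker rho h) _ (in_ker_conj g k).

Lemma val_ker_conj g k : val (ker_conj g k) = (g * val k * g^-1)%g.
Proof. by []. Qed.

Lemma ker_conjK g : cancel (ker_conj g) (ker_conj g^-1%g).
Proof.
move=> k; apply: val_inj; rewrite !val_ker_conj invgK !mulgA.
by rewrite mulVg mul1g mulgVK.
Qed.

Lemma ker_conjVK g : cancel (ker_conj g^-1%g) (ker_conj g).
Proof. by move=> k; have := ker_conjK g^-1%g k; rewrite invgK. Qed.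

Lemma ker_conjM g k l : ker_conj g (k * l)%g = (ker_conj g k * ker_conj g l)%g.
Proof.
apply: val_inj; rewrite valM_ker !val_ker_conj valM_ker !mulgA.
by rewrite mulgVK.
Qed.

(** The scalar in [u_g u_k = conj_phase(g,k) u_(gkg^-1) u_g]. *)
Definition conj_phase g k : R[i] := c g (val k) / c (val (ker_conj g k)) g.

Lemma conj_phase_norm g k : `|conj_phase g k| = 1.
Proof. by case: c_cochain => c1 _ _; rewrite normf_div !c1 divr1. Qed.

Let val_conjM g k h : (val (ker_conj g k) * (g * h))%g = (g * (val k * h))%g.
Proof. by rewrite val_ker_conj !mulgA mulgVK. Qed.

Let val_conj g k : (val (ker_conj g k) * g)%g = (g * val k)%g.
Proof. by rewrite val_ker_conj mulgVK. Qed.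

(** [Ad_g(u_k) Ad_g(u_l) = Ad_g(u_k u_l)].  The three instances of the cocycle
    identity move [u_g] past [u_k] and [u_l]; each of them has an index in the
    kernel. *)
Lemma conj_phaseM g k l :
  conj_phase g k * conj_phase g l *
    c (val (ker_conj g k)) (val (ker_conj g l)) =
  conj_phase g (k * l)%g * c (val k) (val l).
Proof.
rewrite /conj_phase ker_conjM !valM_ker.
have := cocycle_kerl (ker_conj g k) (val (ker_conj g l)) g.
have := cocycle_kerl (ker_conj g k) g (val l).
have := cocycle_kerm g k (val l).
rewrite !val_conj; move: (val (ker_conj g k)) (val (ker_conj g l)) => k' l'.
move=> E1 E2 E3.
have {}E1 : c g (val k) =
    c (val k) (val l) * c g (val k * val l)%g / c (g * val k)%g (val l).
  by apply: (mulIf (c_neq0 (g * val k)%g (val l))); rewrite mulfVK.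
have {}E3 : c k' l' = c l' g * c k' (g * val l)%g / c (k' * l')%g g.
  by apply: (mulIf (c_neq0 (k' * l')%g g)); rewrite mulfVK.
have {}E2 : c k' (g * val l)%g = c k' g * c (g * val k)%g (val l) / c g (val l).
  by apply: (mulfI (c_neq0 g (val l))); rewrite -E2 [RHS]mulrC divfK.
by rewrite E3 E2 E1; field; rewrite !c_neq0.
Qed.

(** [Ad_f Ad_g = Ad_(fg)] holds exactly: [u_f u_g] and [u_(fg)] differ by a
    scalar, which conjugation does not see, and the associators involved have an
    index in the kernel. *)
Lemma conj_phase_comp f g k :
  conj_phase f (ker_conj g k) * conj_phase g k = conj_phase (f * g)%g k.
Proof.
rewrite /conj_phase; set k1 := ker_conj g k; set k2 := ker_conj f k1.
have k2E : ker_conj (f * g)%g k = k2.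
  by apply: val_inj; rewrite !val_ker_conj invgM !mulgA.
have E1 := cocycle_kerr f g k.
have E2 := cocycle_kerm f k1 g.
have E3 := cocycle_kerl k2 f g.
rewrite !val_conj in E2 E3; rewrite k2E.
have {}E1 : c (f * g)%g (val k) = c g (val k) * c f (g * val k)%g / c f g.
  by apply: (mulfI (c_neq0 f g)); rewrite E1 [RHS]mulrC divfK.
have {}E3 : c (f * val k1)%g g = c f g * c (val k2) (f * g)%g / c (val k2) f.
  by apply: (mulfI (c_neq0 (val k2) f)); rewrite E3 [RHS]mulrC divfK.
have {}E2 : c f (val k1) =
    c (val k1) g * c f (g * val k)%g / c (f * val k1)%g g.
  by apply: (mulIf (c_neq0 (f * val k1)%g g)); rewrite mulfVK.
by rewrite E1 E2 E3; field; rewrite !c_neq0.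
Qed.

Definition conj_symmetry g : crossed_symmetry (fun k l => c (val k) (val l))
    (fun k => pi (val k)).
Proof.
apply: (@CrossedSymmetry _ _ _ _ _ _ _ (ker_conjK g) (ker_conjVK g)
  (ker_conjM g) (pi g) (conj_phase g) (conj_phase_norm g) _ (conj_phaseM g)).
by move=> k b; rewrite -!piM val_conj.
Defined.

Lemma conj_symmetry_comp f g x :
  sym_act (conj_symmetry f) (sym_act (conj_symmetry g) x) =
  sym_act (conj_symmetry (f * g)%g) x.
Proof.
apply/funext => k; rewrite /sym_act /= star_autZ scalerA -piM.
have -> : ker_conj (f * g)^-1%g k = ker_conj g^-1%g (ker_conj f^-1%g k).
  by apply: val_inj; rewrite !val_ker_conj !invgM !invgK !mulgA.
by rewrite -conj_phase_comp ker_conjVK.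
Qed.

Let ker_cochain : cochain2 (fun k l => c (val k) (val l)).
Proof.
case: c_cochain => c1 c1l c1r; split=> [k l|k|k]; rewrite ?val1_ker.
- exact: c1.
- exact: c1l.
- exact: c1r.
Qed.

Let ker_cocycle k l (n : group_ker rho) :
  c (val k) (val l) * c (val (k * l)%g) (val n) =
  c (val l) (val n) * c (val k) (val (l * n)%g).
Proof.
by rewrite !valM_ker; exact: cocycle_kerl.
Qed.

Let ker_piM k l b : pi (val (k * l)%g) b = pi (val k) (pi (val l) b).
Proof. by rewrite valM_ker piM. Qed.

Context (D : reduced_crossed_product (fun k l => c (val k) (val l))
  (fun k : group_ker rho => pi (val k))).

Let Ad g : star_aut D := crossed_aut ker_cochain ker_piM D (conj_symmetry g).
Let u k : multiplier D := translation ker_cochain ker_cocycle ker_piM D k.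

Let Ad_comp f g d : Ad f (Ad g d) = Ad (f * g)%g d.
Proof. by apply: crossed_aut_comp => x; exact: conj_symmetry_comp. Qed.

Let Ad_ker k d : lmult (u k) d = rmult (u k) (Ad (val k) d).
Proof.
apply: translation_inner => // n.
  by apply: val_inj; rewrite !valM_ker valV_ker.
by rewrite /= /conj_phase divfK.
Qed.

Context (s : Q -> G) (sK : cancel s rho).

Let defect_in_ker q r : in_ker rho (s (q * r) * (s q * s r)^-1)%g.
Proof.
have := congr1 rho (mulgVK (s q * s r)%g (s (q * r)%g)).
rewrite gmulfM [rho (s q * s r)%g]gmulfM !sK => E.
by apply/eqP/(@mulIg _ (q * r)%g); rewrite E mul1g.
Qed.

(** The [j] in the kernel with [j (s q) (s r) = s (q r)]: it measures how far
    the section is from a homomorphism. *)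
Definition defect q r : group_ker rho :=
  exist (fun h => in_ker rho h) _ (defect_in_ker q r).

Lemma defectE q r : (val (defect q r) * (s q * s r))%g = s (q * r)%g.
Proof. exact: mulgVK. Qed.

(** The scalar [z] for which [z u_j (u_(s q) u_(s r)) = u_(s (q r))], where [j]
    is the defect of [q] and [r]. *)
Definition anomaly_phase q r : R[i] :=
  (c (s q) (s r) * c (val (defect q r)) (s q * s r)%g)^-1.

(** Both sides are [s(qrt) ((s q) (s r) (s t))^-1]. *)
Lemma defect_identity q r t : (defect (q * r) t * defect q r)%g =
   (defect q (r * t) * ker_conj (s q) (defect r t))%g.
Proof.
apply: val_inj; rewrite !valM_ker val_ker_conj.
have dE q' r' : val (defect q' r') = (s (q' * r')%g * (s q' * s r')^-1)%g by [].
by rewrite !dE !invgM !mulgA !mulgVK.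
Qed.

(** Multiplying [u_(s q)], [u_(s r)] and [u_(s t)] in the two possible orders to
    reach [u_(s (q r t))].  Five of the six cocycle identities have an index in
    the kernel; the sixth, at [s q], [s r], [s t], produces [omega]. *)
Lemma anomaly_phase_identity q r t :
  omega q r t * (anomaly_phase (q * r)%g t * anomaly_phase q r *
     c (val (defect (q * r)%g t)) (val (defect q r))) =
  anomaly_phase q (r * t)%g * anomaly_phase r t *
    conj_phase (s q) (defect r t) *
    c (val (defect q (r * t)%g)) (val (ker_conj (s q) (defect r t))).
Proof.
rewrite /anomaly_phase /conj_phase.
have J := congr1 val (defect_identity q r t); rewrite !valM_ker in J.
have A1 := cocycle_kerl (defect q r) (s q * s r)%g (s t).
have A2 := cocycle_kerl (defect (q * r)%g t) (val (defect q r))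
  (s q * (s r * s t))%g.
have A3 := twisted_cocycle (s q) (s r) (s t).
have A4 := cocycle_kerl (ker_conj (s q) (defect r t)) (s q) (s r * s t)%g.
have A5 := cocycle_kerm (s q) (defect r t) (s r * s t)%g.
have A6 := cocycle_kerl (defect q (r * t)%g)
  (val (ker_conj (s q) (defect r t))) (s q * (s r * s t))%g.
rewrite defectE -mulgA in A1.
have pE : (val (defect q r) * (s q * (s r * s t)) = s (q * r) * s t)%g.
  by rewrite -defectE !mulgA.
rewrite J pE in A2.
rewrite val_conj in A4.
rewrite defectE in A5.
rewrite val_conjM defectE in A6.
rewrite !sK in A3.
move: A1 A2 A3 A4 A5 A6.
set a := s q; set b := s r; set d := s t; set p := s _; set r' := s _.
set j1 := val (defect (q * r)%g t); set j2 := val (defect q r).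
set j3 := val (defect r t); set j4 := val (defect q (r * t)%g).
set i := val (ker_conj _ _); set X := c (j4 * i)%g _; set Y := c (a * j3)%g _.
move=> A1 A2 A3 A4 A5 A6.
have X0 : X != 0 by exact: c_neq0.
have Y0 : Y != 0 by exact: c_neq0.
(* Solving each identity for one value of [c] turns the goal into a cancellation
   of fractions. *)
have {}A1 : c p d = c (a * b)%g d * c j2 (a * (b * d))%g / c j2 (a * b)%g.
  by rewrite -A1 [_ * c p d]mulrC mulfK.
have {}A2 : c j1 j2 = c j2 (a * (b * d))%g * c j1 (p * d)%g / X.
  by rewrite -A2 mulfK.
have {}A3 : omega q r t = c a b * c (a * b)%g d / (c b d * c a (b * d)%g).
  by rewrite A3 mulfK// mulf_neq0.
have {}A4 : c i a = c a (b * d)%g * c i (a * (b * d))%g / Y.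
  by rewrite -A4 mulfK.
have {}A5 : c a j3 = c j3 (b * d)%g * c a r' / Y by rewrite -A5 mulfK.
have {}A6 : c j4 i = c i (a * (b * d))%g * c j4 (a * r')%g / X.
  by rewrite -A6 mulfK.
by rewrite A1 A2 A3 A4 A5 A6; field; rewrite X0 Y0 !c_neq0.
Qed.

Let alpha q := Ad (s q).
Let m q r := mult_scale (anomaly_phase q r) (u (defect q r)).

Lemma anomalous_action_of_section : anomalous_action omega alpha m.
Proof.
split=> [q r|q r d|q r t].
- apply: scaled_translation_unitary.
  by case: c_cochain => c1 _ _; rewrite normfV normrM !c1 mulr1 invr1.
- rewrite /= Ad_comp Ad_ker; congr (_ *: rmult _ _).
  by rewrite /alpha Ad_comp defectE.
- rewrite /m aut_mult_scale aut_mult_translation.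
  rewrite !mult_mul_scalel !mult_mul_scaler !mult_scaleA !translationM.
  rewrite !mult_scaleA.
  rewrite defect_identity; congr mult_scale.
  by have := anomaly_phase_identity q r t; rewrite !mulrA.
Qed.

End GroupExtension.

Theorem theorem3p1 (R : realType)
    (Q : groupType) (omega : Q -> Q -> Q -> R[i]) (omegaP : cocycle3 omega)
    (G : groupType) (rho : {multiplicative G -> Q})
    (rho_surj : forall q : Q, exists g : G, rho g = q)
    (c : G -> G -> R[i]) (cP : cochain2 c)
    (dcP : forall f g h : G, coboundary2 c f g h = pullback3 rho omega f g h)
    (B : cstarAlgType R) (pi : G -> star_aut B)
    (piM : forall (g h : G) (b : B), pi (g * h)%g b = pi g (pi h b))
    (D : reduced_crossed_product
           (fun k l : group_ker rho => c (val k) (val l))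
           (fun k : group_ker rho => pi (val k))) :
  exists (alpha : Q -> star_aut D) (m : Q -> Q -> multiplier D),
    anomalous_action omega alpha m.
Proof.
have [s sK] := choice rho_surj.
have [omega_cochain _] := omegaP.
do 2!eexists.
exact: (anomalous_action_of_section omega_cochain cP dcP piM D sK).
Qed.
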